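(* Let $\mathfrak{IV}$ be an integral vessel and let $$S(\lambda,t_2)=D(t_2)+C(t_2)(\lambda I-A_1(t_2))^{-1}\widetilde B(t_2)\sigma_1(t_2)$$ be its transfer function, defined for $\lambda$ outside the spectrum of $A_1(t_2)$ (which does not depend on $t_2$). Then: 1. For almost all $t_2$, $S(\lambda,t_2)$ is an analytic function of $\lambda$ in a neighborhood of $\infty$, and $S(\infty,t_2)=D(t_2)$. 2. For all $\lambda$ (outside the spectrum of $A_1$), $S(\lambda,t_2)$ is an absolutely continuous function of $t_2$. 3. For each fixed $\lambda$ (outside the spectrum of $A_1$), multiplication by $S(\lambda,t_2)$ maps solutions $u(t_2)$ of $$\lambda\sigma_2(t_2)u-\sigma_1(t_2)\frac{du}{dt_2}+\gamma(t_2)u=0$$ to solutions $y(t_2)=S(\lambda,t_2)u(t_2)$ of $$\lambda\sigma_{2*}(t_2)y-\sigma_{1*}(t_2)\frac{dy}{dt_2}+\gamma_*(t_2)y=0.$$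
   Context: Subscripts $*$ (as in $\sigma_{1*},\gamma_*,\mathcal E_*$) are part of the name and do not denote adjoints. ''Absolutely continuous'' and ''$L^1_{loc}$'' refer to the operator norm; absolutely continuous means on compact intervals. The variable $t_2$ ranges over an interval $I\subseteq\mathbb R$. A solution of one of the ODEs is an absolutely continuous vector function satisfying it for almost all $t_2$. An (integral) vessel is a collection $$\mathfrak{IV}=(A_1(t_2),F(t_2,t_2^0),\widetilde B(t_2),C(t_2),D(t_2),\widetilde D(t_2);\sigma_1,\sigma_2,\gamma,\sigma_{1*},\sigma_{2*},\gamma_*;\mathcal H_{t_2},\mathcal E,\mathcal E_*,\widetilde{\mathcal E},\widetilde{\mathcal E}_* )$$ of Hilbert spaces and operator functions of $t_2$ with the following properties. (i) $F$ is an evolution semi-group: $F(t,s):\mathcal H_s\to\mathcal H_t$ is bounded and invertible, $F(r,s)F(s,t)=F(r,t)$, $F(t,t)=I$. (ii) $A_1(t_2):\mathcal H_{t_2}\to\mathcal H_{t_2}$, $\widetilde B(t_2):\widetilde{\mathcal E}\to\mathcal H_{t_2}$, $C(t_2):\mathcal H_{t_2}\to\mathcal E_*$ are bounded; for (almost) all $t$ the functions $s\mapsto F(t,s)\widetilde B(s)\sigma_1(s)$, $s\mapsto F(t,s)\widetilde B(s)\sigma_2(s)$, $s\mapsto C(s)F(s,t)$ are absolutely continuous. (iii) $D(t_2):\mathcal E\to\mathcal E_*$ and $\widetilde D(t_2):\widetilde{\mathcal E}\to\widetilde{\mathcal E}_*$ are absolutely continuous. (iv) $\sigma_2,\gamma\in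 L^1_{loc}$ with values in $\mathcal L(\mathcal E,\widetilde{\mathcal E})$; $\sigma_1(t_2)\in\mathcal L(\mathcal E,\widetilde{\mathcal E})$ is absolutely continuous with invertible values; likewise $\sigma_{2*},\gamma_*\in L^1_{loc}$ with values in $\mathcal L(\mathcal E_*,\widetilde{\mathcal E}_* )$ and $\sigma_{1*}(t_2)\in\mathcal L(\mathcal E_*,\widetilde{\mathcal E}_* )$ is absolutely continuous with invertible values. (v) The vessel conditions hold (those with derivatives for almost all $t_2$): $F(t_2,t_2^0)A_1(t_2^0)=A_1(t_2)F(t_2,t_2^0)$; $\frac{d}{dt_2}\big(F(t_2^0,t_2)\widetilde B\sigma_1\big)+F(t_2^0,t_2)A_1\widetilde B\sigma_2+F(t_2^0,t_2)\widetilde B\gamma=0$; $\sigma_{2*}CA_1F(t_2,t_2^0)-\sigma_{1*}\frac{d}{dt_2}[CF(t_2,t_2^0)]+\gamma_*CF(t_2,t_2^0)=0$; $\sigma_{1*}D=\widetilde D\sigma_1$, $\sigma_{2*}D=\widetilde D\sigma_2$, $\widetilde D\gamma=\sigma_{2*}C\widetilde B\sigma_1-\sigma_{1*}C\widetilde B\sigma_2-\sigma_{1*}\frac{dD}{dt_2}+\gamma_*D$. *)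

(* Defs.v *)
From HB Require Import structures.
From mathcomp Require Import all_boot all_order all_algebra.
From mathcomp Require Import complex.
From mathcomp Require Import all_classical all_reals all_analysis.

Set Implicit Arguments.
Unset Strict Implicit.
Unset Printing Implicit Defensive.

Import Order.TTheory GRing.Theory Num.Theory.
Import numFieldNormedType.Exports.

Local Open Scope classical_set_scope.
Local Open Scope complex_scope.
Local Open Scope ring_scope.

(* The scalar product is linear in its first argument. *)
HB.mixin Record CompleteNormedModule_isHilbert (R : realType) V
    of CompleteNormedModule R[i] V := {
  hdot : V -> V -> R[i] ;
  hdot_linear : forall z a x y, hdot (a *: x + y) z = a * hdot x z + hdot y z ;
  hdot_conj : forall x y, hdot y x = Num.conj (hdot x y) ;
  hdot_norm : forall x, hdot x x = `|x| ^+ 2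
}.

#[short(type="hilbertType")]
HB.structure Definition Hilbert (R : realType) :=
  {V of CompleteNormedModule R[i] V & CompleteNormedModule_isHilbert R V}.

Section BoundedOperators.
Variables (R : realType) (V W : normedModType R[i]).

Definition op_bound (f : V -> W) : set R :=
  [set M | 0 <= M /\ forall x, `|f x| <= M%:C * `|x|].

Definition bounded_linear : {pred V -> W} :=
  fun f => `[< linear f /\ op_bound f !=set0 >].

Record bop := Bop { bop_fun :> V -> W ; bopP : bop_fun \in bounded_linear }.

HB.instance Definition _ := [isSub for bop_fun].
HB.instance Definition _ := [Choice of bop by <:].

Lemma bounded_linearP (f : V -> W) :
  reflect (linear f /\ op_bound f !=set0) (f \in bounded_linear).
Proof. exact: asboolP. Qed.

Lemma bounded_linear_submod : submod_closed bounded_linear.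
Proof.
split=> [|a f g /bounded_linearP[lf [M [M0 fM]]] /bounded_linearP[lg [N [N0 gN]]]].
  apply/bounded_linearP; split=> [a x y|]; first by rewrite /= scaler0 addr0.
  by exists 0; split=> // x; rewrite normr0 mul0r.
apply/bounded_linearP; split=> [b x y|].
  change (a *: f (b *: x + y) + g (b *: x + y) =
    b *: (a *: f x + g x) + (a *: f y + g y)).
  rewrite lf lg !scalerDr !scalerA (mulrC b) -!addrA; congr (_ + _).
  by rewrite addrCA.
exists (complex.Re `|a| * M + N); split=> [|x].
  by rewrite addr_ge0// mulr_ge0//; case: a => ? ? /=; exact: sqrtr_ge0.
change (`|a *: f x + g x| <= (complex.Re `|a| * M + N)%:C * `|x|).
rewrite (le_trans (ler_normD _ _))// normrZ rmorphD rmorphM/= mulrDl.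
have -> : (complex.Re `|a|)%:C = `|a| by [].
by rewrite lerD// -mulrA ler_wpM2l.
Qed.

HB.instance Definition _ :=
  GRing.isSubmodClosed.Build R[i] (V -> W) bounded_linear bounded_linear_submod.
HB.instance Definition _ := [SubChoice_isSubLmodule of bop by <:].

Lemma bop_linear (f : bop) : linear f.
Proof. by have /bounded_linearP[] := bopP f. Qed.

HB.instance Definition _ (f : bop) :=
  GRing.isLinear.Build R[i] V W *:%R f (bop_linear f).

Implicit Types f g : bop.

Definition opnorm (f : bop) : R := inf (op_bound f).

Lemma op_bound_neq0 (f : bop) : op_bound f !=set0.
Proof. by have /bounded_linearP[] := bopP f. Qed.

Lemma op_bound_lb (f : V -> W) : has_lbound (op_bound f).
Proof. by exists 0 => M []. Qed.

Lemma opnorm_ge0 f : 0 <= opnorm f.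
Proof. by apply: lb_le_inf; [exact: op_bound_neq0|move=> M []]. Qed.

Lemma opnorm_le (f : bop) M : op_bound f M -> opnorm f <= M.
Proof. by move=> fM; apply: ge_inf => //; exact: op_bound_lb. Qed.

Lemma normE (U : normedModType R[i]) (x : U) : `|x| = (complex.Re `|x|)%:C.
Proof.
by have := normr_ge0 x; rewrite -complexr0; case: `|x| => a b;
  rewrite lecE/= => /andP[/eqP ->].
Qed.

Lemma op_bound_opnorm f : op_bound f (opnorm f).
Proof.
split=> [|x]; first exact: opnorm_ge0.
have [->|x0] := eqVneq x 0; first by rewrite raddf0 !normr0 mulr0.
have nx0 : 0 < complex.Re `|x|.
  by rewrite -ltcR -normE normr_gt0.
rewrite (normE (f x)) (normE x) -rmorphM lecR -ler_pdivrMr//.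
apply: lb_le_inf; first exact: op_bound_neq0.
move=> M [M0 fM]; rewrite ler_pdivrMr// -lecR -normE.
by have := fM x; rewrite (normE x) -rmorphM.
Qed.

Lemma opnorm_triangle f g : (opnorm (f + g))%:C <= (opnorm f)%:C + (opnorm g)%:C.
Proof.
rewrite -rmorphD lecR; apply: opnorm_le; split=> [|x].
  by rewrite addr_ge0// opnorm_ge0.
change (`|f x + g x| <= (opnorm f + opnorm g)%:C * `|x|).
rewrite (le_trans (ler_normD _ _))// rmorphD mulrDl lerD//.
  by have [_] := op_bound_opnorm f.
by have [_] := op_bound_opnorm g.
Qed.

Lemma opnormZ a f : (opnorm (a *: f))%:C = `|a| * (opnorm f)%:C.
Proof.
have le b g : (opnorm (b *: g))%:C <= `|b| * (opnorm g)%:C.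
  rewrite (normE (b : R[i]^o)) -rmorphM lecR; apply: opnorm_le; split=> [|x].
    by rewrite mulr_ge0 ?opnorm_ge0// -lecR -normE; exact: normr_ge0.
  change (`|b *: g x| <= (complex.Re `|b| * opnorm g)%:C * `|x|).
  have -> : (complex.Re `|b| * opnorm g)%:C = `|b| * (opnorm g)%:C.
    by rewrite rmorphM.
  rewrite normrZ -mulrA ler_wpM2l//.
  by have [_] := op_bound_opnorm g.
apply/eqP; rewrite eq_le le/=.
have [->|a0] := eqVneq a 0.
  by rewrite normr0 mul0r lecR opnorm_ge0.
by rewrite -ler_pdivlMl ?normr_gt0// -normfV -{1}(scalerK a0 f) le.
Qed.

Lemma opnorm_eq0 f : (opnorm f)%:C = 0 -> f = 0.
Proof.
move=> /(congr1 (@complex.Re R))/= f0; apply: val_inj; apply/funext => x.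
by have [_ /(_ x)] := op_bound_opnorm f; rewrite f0 mul0r normr_le0 => /eqP.
Qed.

HB.instance Definition _ := Lmodule_isNormed.Build R[i] bop
  opnorm_triangle opnormZ opnorm_eq0.

End BoundedOperators.

Section Composition.
Variables (R : realType) (U V W : normedModType R[i]).

Lemma bid_proof : (@idfun V) \in @bounded_linear R V V.
Proof.
by apply/bounded_linearP; split=> //; exists 1; split=> // x; rewrite mul1r.
Qed.

Definition bid : bop V V := Bop bid_proof.

Lemma bcomp_proof (g : bop V W) (f : bop U V) : g \o f \in @bounded_linear R U W.
Proof.
apply/bounded_linearP; split=> [a x y|]; first by rewrite /= !linearP.
exists (opnorm g * opnorm f); split=> [|x]; first by rewrite mulr_ge0 ?opnorm_ge0.
have [g0 gn] := op_bound_opnorm g; have [f0 fn] := op_bound_opnorm f.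
rewrite (le_trans (gn _))// rmorphM -mulrA ler_wpM2l//.
by rewrite lecR.
Qed.

Definition bcomp (g : bop V W) (f : bop U V) : bop U W := Bop (bcomp_proof g f).

End Composition.

Arguments bid {R V}.
Notation "g *o f" := (bcomp g f) (at level 40, left associativity) : ring_scope.

Section Inverse.
Variables (R : realType) (V W : normedModType R[i]).

Definition binverse (T : bop V W) : set (bop W V) :=
  [set S | T *o S = bid /\ S *o T = bid].

Definition binvertible (T : bop V W) : Prop := binverse T !=set0.

(* Total inverse: the zero operator when T is not invertible. *)
Definition binv (T : bop V W) : bop W V := xget 0 (binverse T).

End Inverse.

Definition spectrum (R : realType) (V : normedModType R[i]) (A : bop V V) : set R[i] :=
  [set z | ~ binvertible (z *: bid - A)].

Section VectorFunctions.
Variables (R : realType) (V : normedModType R[i]).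
Local Notation mu := (@lebesgue_measure R).

Definition abs_continuous_itv (a b : R) (f : R -> V) : Prop :=
  forall e : R, 0 < e -> exists2 d : R, 0 < d &
    forall (n : nat) (l r : 'I_n -> R),
      (forall i, [/\ a <= l i, l i <= r i & r i <= b]) ->
      (forall i j, i != j -> r i <= l j \/ r j <= l i) ->
      \sum_i (r i - l i) < d ->
      \sum_i `|f (r i) - f (l i)| < e%:C.

Definition abs_continuous (I : interval R) (f : R -> V) : Prop :=
  forall a b, a \in I -> b \in I -> abs_continuous_itv a b f.

(* Two-sided derivative in the real variable.  Functions on an interval I are
   represented by total functions on R; the derivative is only ever required at
   almost every point of I, hence only matters at interior points. *)
Definition has_deriv (f : R -> V) (t : R) (df : V) : Prop :=
  (h^-1)%:C *: (f (t + h) - f t) @[h --> 0^'] --> df.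

Definition simple_fun (f : R -> V) : Prop :=
  finite_set (range f) /\ forall v, measurable (f @^-1` [set v]).

(* Bochner measurability. *)
Definition strongly_measurable (I : interval R) (f : R -> V) : Prop :=
  exists s : nat -> R -> V, (forall n, simple_fun (s n)) /\
    {ae mu, forall t, t \in I -> s n t @[n --> \oo] --> f t}.

Definition L1loc (I : interval R) (f : R -> V) : Prop :=
  strongly_measurable I f /\
  forall a b, a \in I -> b \in I ->
    (\int[mu]_(t in `[a, b]) (complex.Re `|f t|)%:E < +oo)%E.

Definition analytic_at (f : R[i] -> V) (z0 : R[i]) : Prop :=
  exists c : nat -> V, \forall z \near (z0 : R[i]^o),
    series (fun n => (z - z0) ^+ n *: c n) n @[n --> \oo] --> f z.

(* f, defined on dom, is analytic in a neighbourhood of infinity and has the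
   value v there: extended by v at 0, z |-> f (1/z) is analytic at 0. *)
Definition analytic_at_infty (dom : set R[i]) (f : R[i] -> V) (v : V) : Prop :=
  (exists r : R, forall z, r%:C < `|z| -> dom z) /\
  analytic_at (fun z => if z == 0 then v else f z^-1) 0.

End VectorFunctions.

(* Derivative of an operator function in the strong operator topology.  An
   operator function that is absolutely continuous for the operator norm need
   not have a norm derivative at any point; whenever the norm derivative exists
   it is also the strong derivative. *)
Definition has_strong_deriv (R : realType) (V W : normedModType R[i])
    (T : R -> bop V W) (t : R) (dT : bop V W) : Prop :=
  forall x, has_deriv (T ^~ x) t (dT x).

(* Absolutely continuous solutions of z sigma2 u - sigma1 u' + gamma u = 0. *)
Definition is_solution (R : realType) (V W : normedModType R[i])
    (I : interval R) (z : R[i]) (sigma2 sigma1 gamma : R -> bop V W)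
    (u : R -> V) : Prop :=
  abs_continuous I u /\
  {ae @lebesgue_measure R, forall t, t \in I -> exists2 du, has_deriv u t du &
    z *: sigma2 t (u t) - sigma1 t du + gamma t (u t) = 0}.

(* The suffix t stands for a tilde and the suffix s for a lower star; vF t s
   acts from the state space at s to the state space at t. *)
Record vessel_data (R : realType) := VesselData {
  vH : R -> hilbertType R ;
  vE : hilbertType R ;
  vEs : hilbertType R ;
  vEt : hilbertType R ;
  vEst : hilbertType R ;
  vA1 : forall t, bop (vH t) (vH t) ;
  vF : forall t s, bop (vH s) (vH t) ;
  vBt : forall t, bop vEt (vH t) ;
  vC : forall t, bop (vH t) vEs ;
  vD : R -> bop vE vEs ;
  vDt : R -> bop vEt vEst ;
  sigma1 : R -> bop vE vEt ;
  sigma2 : R -> bop vE vEt ;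
  gamma : R -> bop vE vEt ;
  sigma1s : R -> bop vEs vEst ;
  sigma2s : R -> bop vEs vEst ;
  gammas : R -> bop vEs vEst
}.

Record is_vessel (R : realType) (I : interval R) (X : vessel_data R) : Prop := {
  vF_inv : forall t s, t \in I -> s \in I -> binvertible (vF X t s) ;
  vF_comp : forall r s t, r \in I -> s \in I -> t \in I ->
    vF X r s *o vF X s t = vF X r t ;
  vF_id : forall t, t \in I -> vF X t t = bid ;

  vFB_ac : {ae @lebesgue_measure R, forall t, t \in I ->
    [/\ abs_continuous I (fun s => vF X t s *o vBt X s *o sigma1 X s),
        abs_continuous I (fun s => vF X t s *o vBt X s *o sigma2 X s) &
        abs_continuous I (fun s => vC X s *o vF X s t)]} ;

  vD_ac : abs_continuous I (vD X) ;
  vDt_ac : abs_continuous I (vDt X) ;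

  sigma2_L1 : L1loc I (sigma2 X) ;
  gamma_L1 : L1loc I (gamma X) ;
  sigma1_ac : abs_continuous I (sigma1 X) ;
  sigma1_inv : forall t, t \in I -> binvertible (sigma1 X t) ;
  sigma2s_L1 : L1loc I (sigma2s X) ;
  gammas_L1 : L1loc I (gammas X) ;
  sigma1s_ac : abs_continuous I (sigma1s X) ;
  sigma1s_inv : forall t, t \in I -> binvertible (sigma1s X t) ;

  vF_A1 : forall t t0, t \in I -> t0 \in I ->
    vF X t t0 *o vA1 X t0 = vA1 X t *o vF X t t0 ;
  vB_ode : forall t0, t0 \in I -> {ae @lebesgue_measure R, forall t, t \in I ->
    exists2 dFB, has_strong_deriv (fun s => vF X t0 s *o vBt X s *o sigma1 X s) t dFB &
      dFB + vF X t0 t *o vA1 X t *o vBt X t *o sigma2 X t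
          + vF X t0 t *o vBt X t *o gamma X t = 0} ;
  vC_ode : forall t0, t0 \in I -> {ae @lebesgue_measure R, forall t, t \in I ->
    exists2 dCF, has_strong_deriv (fun s => vC X s *o vF X s t0) t dCF &
      sigma2s X t *o vC X t *o vA1 X t *o vF X t t0 - sigma1s X t *o dCF
          + gammas X t *o vC X t *o vF X t t0 = 0} ;
  link_sigma1 : forall t, t \in I -> sigma1s X t *o vD X t = vDt X t *o sigma1 X t ;
  link_sigma2 : forall t, t \in I -> sigma2s X t *o vD X t = vDt X t *o sigma2 X t ;
  link_gamma : {ae @lebesgue_measure R, forall t, t \in I ->
    exists2 dD, has_strong_deriv (vD X) t dD &
      vDt X t *o gamma X t =
        sigma2s X t *o vC X t *o vBt X t *o sigma1 X t
        - sigma1s X t *o vC X t *o vBt X t *o sigma2 X t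
        - sigma1s X t *o dD + gammas X t *o vD X t}
}.

Definition transfer (R : realType) (X : vessel_data R) (z : R[i]) (t : R) :
    bop (vE X) (vEs X) :=
  vD X t + vC X t *o binv (z *: bid - vA1 X t) *o vBt X t *o sigma1 X t.

(* Main.v *)
Require Import Defs.
From mathcomp Require Import all_boot all_order all_algebra.
From mathcomp Require Import complex.
From mathcomp Require Import ring lra.
From mathcomp Require Import all_classical all_reals all_analysis.

Import Order.TTheory GRing.Theory Num.Theory.
Import numFieldNormedType.Exports.

Local Open Scope classical_set_scope.
Local Open Scope complex_scope.
Local Open Scope ring_scope.

(** The evolution operators F(t,s) intertwine the A_1(t), so all the A_1(t) are
    similar: they have one spectrum, and for a fixed base point s

      S(lambda,t) = D(t) + [C(t) F(t,s)] (lambda - A_1(s))^-1 [F(s,t) B(t) sigma_1(t)],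

    where the resolvent no longer depends on t (lemma [transfer_transport]).
    The two bracketed factors are exactly the functions of t that a vessel
    requires to be absolutely continuous, for almost every s; an interval with
    two points has positive measure, so such an s exists.  Since absolutely
    continuous functions are bounded on compact intervals, they are stable under
    bounded bilinear products, and S(lambda,.) is absolutely continuous.

    For the differential equations, the same factorization is differentiated by
    the product rule at almost every t.  The derivatives of the operator
    functions exist only strongly, and the product rule [has_deriv_app] survives
    because the operators are locally bounded in norm.  Substituting the vessel
    conditions at t and using that the resolvent inverts lambda - A_1(t) then
    turns the input equation into the output equation ([output_equation]).

    Near infinity, lambda - A_1 is inverted by a contraction argument
    ([resolvent_exists]), and with w = 1/lambda the expansion
    S = D + sum_n w^(n+1) C A_1^n B sigma_1 has an explicit remainder, dominated
    by a geometric sequence ([markov_remainder]).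

    Norms of complex normed modules take values in R[i]; estimates are carried
    out with their real parts, so that they are inequalities between reals. *)

(** * Real norms and convergence *)

Section RealNorm.
Set Implicit Arguments.
Unset Strict Implicit.
Context {R : realType}.
Implicit Types U V W : normedModType R[i].

Definition rnorm {V} (x : V) : R := complex.Re `|x|.

Lemma posC_real (e : R[i]) : 0 < e -> e = (complex.Re e)%:C /\ 0 < complex.Re e.
Proof. by case: e => a b; rewrite ltcE /= => /andP[/eqP -> a0]. Qed.

Lemma rnorm_ge0 {V} (x : V) : 0 <= rnorm x.
Proof. by rewrite -lecR; move: (normr_ge0 x); rewrite normE. Qed.

Lemma rnorm0 {V} : rnorm (0 : V) = 0.
Proof. by rewrite /rnorm normr0. Qed.

Lemma rnorm_eq0 {V} (x : V) : rnorm x = 0 -> x = 0.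
Proof. by move=> x0; apply/eqP; rewrite -normr_eq0 normE -/(rnorm x) x0. Qed.

Lemma rnormD {V} (x y : V) : rnorm (x + y) <= rnorm x + rnorm y.
Proof. by rewrite -lecR rmorphD/= -!normE ler_normD. Qed.

Lemma rnormB {V} (x y : V) : rnorm (x - y) = rnorm (y - x).
Proof. by rewrite /rnorm distrC. Qed.

Lemma rnormZ {V} (a : R[i]) (x : V) : rnorm (a *: x) = rnorm (a : R[i]^o) * rnorm x.
Proof.
have eM (p q : R) : p%:C * q%:C = (p * q)%:C by rewrite -rmorphM.
have ea : `|a| = (rnorm (a : R[i]^o))%:C := normE (a : R[i]^o).
have ex : `|x| = (rnorm x)%:C := normE x.
by rewrite {1}/rnorm normrZ ea ex eM.
Qed.

Lemma rnorm_real (r : R) : rnorm (r%:C : R[i]^o) = `|r|.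
Proof. by rewrite /rnorm /= expr0n addr0 sqrtr_sqr. Qed.

Lemma rnormX (w : R[i]) n : rnorm (w ^+ n : R[i]^o) = rnorm (w : R[i]^o) ^+ n.
Proof.
have e1 : `|w ^+ n| = (rnorm (w ^+ n : R[i]^o))%:C := normE (w ^+ n : R[i]^o).
have e2 : `|w| = (rnorm (w : R[i]^o))%:C := normE (w : R[i]^o).
by move: e1; rewrite normrX e2 -rmorphXn => /complexI.
Qed.

Lemma rnorm_opE {V W} (T : bop V W) : rnorm T = opnorm T.
Proof. by []. Qed.

Lemma rnorm_op {V W} (T : bop V W) (x : V) : rnorm (T x) <= rnorm T * rnorm x.
Proof.
by rewrite -lecR rmorphM/= -!normE; have [_] := op_bound_opnorm T; exact.
Qed.

Lemma rnorm_comp {U V W} (T : bop V W) (S : bop U V) :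
  rnorm (T *o S) <= rnorm T * rnorm S.
Proof.
rewrite rnorm_opE; apply: opnorm_le; split; first by rewrite mulr_ge0 ?rnorm_ge0.
move=> x; rewrite (normE ((T *o S) x)) (normE x) -rmorphM lecR -mulrA.
apply: le_trans (rnorm_op T (S x)) _.
by rewrite ler_wpM2l ?rnorm_ge0// rnorm_op.
Qed.

Lemma cvg_rnormP {V} {T : Type} (F : set_system T) {FF : Filter F} (f : T -> V) (l : V) :
  f x @[x --> F] --> l <-> rnorm (f x - l) @[x --> F] --> (0 : R).
Proof.
split=> [/cvgrPdist_lt fl|/cvgrPdist_lt fl]; apply/cvgrPdist_lt => e e0.
  have e0C : 0 < e%:C by rewrite ltcR.
  apply: filterS (fl _ e0C) => x; rewrite normE ltcR => h.
  by rewrite sub0r normrN ger0_norm ?rnorm_ge0// rnormB.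
have [-> e1] := posC_real e0; apply: filterS (fl _ e1) => x.
by rewrite sub0r normrN ger0_norm ?rnorm_ge0// rnormB normE ltcR.
Qed.

(** Limits are proved below by bounding a norm by a quantity that tends to 0. *)
Lemma cvg0_le {T : Type} (F : set_system T) {FF : Filter F} (f g : T -> R) :
  (\forall x \near F, 0 <= f x <= g x) -> g x @[x --> F] --> 0 ->
  f x @[x --> F] --> 0.
Proof.
move=> fg g0; apply: (@squeeze_cvgr _ _ _ _ (fun=> 0) _ _ fg) => //.
exact: cvg_cst.
Qed.

Lemma cvg0M {T : Type} (F : set_system T) {FF : Filter F} (K : R) (f : T -> R) :
  f x @[x --> F] --> 0 -> K * f x @[x --> F] --> 0.
Proof. by move=> f0; rewrite -[X in _ --> X](mulr0 K); exact: cvgMl_tmp. Qed.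

Lemma cvg0D {T : Type} (F : set_system T) {FF : Filter F} (f g : T -> R) :
  f x @[x --> F] --> 0 -> g x @[x --> F] --> 0 -> f x + g x @[x --> F] --> 0.
Proof. by move=> f0 g0; rewrite -[X in _ --> X](addr0 0); exact: cvgD. Qed.

Lemma bop_ext {V W} (S T : bop V W) : (forall x, S x = T x) -> S = T.
Proof. by move=> ST; apply: val_inj; apply/funext. Qed.

End RealNorm.

(** * Absolutely continuous functions *)

Section AbsoluteContinuity.
Set Implicit Arguments.
Unset Strict Implicit.
Context {R : realType}.
Implicit Types U V W : normedModType R[i].
Implicit Types a b : R.

Definition incr_sum {V} (f : R -> V) n (l r : 'I_n -> R) : R :=
  \sum_i rnorm (f (r i) - f (l i)).

Lemma incr_sumE {V} (f : R -> V) n (l r : 'I_n -> R) :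
  \sum_i `|f (r i) - f (l i)| = (incr_sum f l r)%:C.
Proof. by rewrite /incr_sum rmorph_sum; apply: eq_bigr => i _; exact: normE. Qed.

(** A vessel may live over an interval reduced to a point, where no base point
    with absolutely continuous factors need exist; this covers that case. *)
Lemma abs_continuous_degenerate {V} a b (f : R -> V) :
  b <= a -> abs_continuous_itv a b f.
Proof.
move=> ba e e0; exists 1 => // n l r lr _ _.
rewrite incr_sumE ltcR /incr_sum big1 // => i _.
have [al lri rb] := lr i.
have -> : r i = l i by apply/eqP; rewrite eq_le lri andbT; lra.
by rewrite subrr rnorm0.
Qed.

Lemma abs_continuous_cst {V} a b (x : V) : abs_continuous_itv a b (fun=> x).
Proof.
move=> e e0; exists 1 => // n l r _ _ _.
by rewrite (incr_sumE (fun=> x) l r) ltcR /incr_sum big1 // => i _; rewrite subrr rnorm0.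
Qed.

Lemma abs_continuous_eq {V} a b (f g : R -> V) :
  (forall t, a <= t <= b -> f t = g t) ->
  abs_continuous_itv a b f -> abs_continuous_itv a b g.
Proof.
move=> fg fac e e0; have [d d0 fd] := fac e e0; exists d => // n l r lr dj sd.
have := fd n l r lr dj sd; rewrite !incr_sumE.
suff -> : incr_sum g l r = incr_sum f l r by [].
apply: eq_bigr => i _; have [al lri rb] := lr i.
by rewrite !fg//; apply/andP; split=> //; lra.
Qed.

Lemma abs_continuousD {V} a b (f g : R -> V) :
  abs_continuous_itv a b f -> abs_continuous_itv a b g ->
  abs_continuous_itv a b (fun t => f t + g t).
Proof.
move=> fac gac e e0; have e20 : 0 < e / 2 by lra.
have [d d0 fd] := fac _ e20; have [d' d'0 gd] := gac _ e20.
exists (Num.min d d'); first by rewrite lt_min d0.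
move=> n l r lr dj; rewrite lt_min => /andP[sd sd'].
have := fd n l r lr dj sd; have := gd n l r lr dj sd'.
rewrite (incr_sumE f l r) (incr_sumE g l r) (incr_sumE (fun t => f t + g t) l r).
rewrite !ltcR => gl fl.
suff : incr_sum (fun t => f t + g t) l r <= incr_sum f l r + incr_sum g l r by lra.
rewrite /incr_sum -big_split/=; apply: ler_sum => i _.
by rewrite opprD addrACA rnormD.
Qed.

(** The modulus for the tolerance 1 makes f move by at most 1 over each step of
    length d / 2, and finitely many steps reach every point of [a, b]. *)
Lemma abs_continuous_bounded {V} a b (f : R -> V) :
  abs_continuous_itv a b f ->
  exists2 M, 0 <= M & forall t, a <= t <= b -> rnorm (f t) <= M.
Proof.
move=> fac; have [d d0 fd] := fac 1 ltr01.
have step s t : a <= s -> s <= t -> t <= b -> t - s < d -> rnorm (f t - f s) < 1.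
  move=> as_ st tb std.
  have := fd 1%N (fun=> s) (fun=> t); rewrite (incr_sumE f) ltcR /incr_sum !big_ord1.
  by apply=> // i j; rewrite !ord1.
have chain n t : a <= t <= b -> t - a <= n%:R * (d / 2) ->
    rnorm (f t) <= rnorm (f a) + n%:R.
  elim: n t => [|n IH] t /andP[at_ tb] tn.
    have -> : t = a by apply/eqP; rewrite eq_le at_ andbT; lra.
    by rewrite addr0.
  have [tn'|tn'] := leP (t - a) (n%:R * (d / 2)).
    by rewrite (le_trans (IH t _ tn')) ?at_//= lerD2l ler_nat.
  have nd0 : 0 <= n%:R * (d / 2) by rewrite mulr_ge0// ltW//; lra.
  pose s := a + n%:R * (d / 2).
  have ds : s - a = n%:R * (d / 2) by rewrite /s; lra.
  have fs : rnorm (f s) <= rnorm (f a) + n%:R.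
    apply: IH; last by rewrite ds.
    by apply/andP; split; lra.
  have : rnorm (f t - f s) < 1.
    apply: step; [lra|lra|lra|].
    by move: tn; rewrite -natr1 mulrDl mul1r -ds; lra.
  have := rnormD (f t - f s) (f s); rewrite subrK -natr1; lra.
have [ba|ab] := ltP b a.
  by exists 0 => // t; lra.
pose N := (Num.trunc ((b - a) / (d / 2))).+1.
exists (rnorm (f a) + N%:R) => [|t /[dup] tab /andP[at_ tb]].
  by rewrite addr_ge0 ?rnorm_ge0.
apply: chain => //.
have : (b - a) / (d / 2) < N%:R by rewrite truncnS_gt.
rewrite ltr_pdivrMr; last lra.
lra.
Qed.

(** Leibniz splitting of the increments of a product; boundedness of the two
    factors turns it into a linear estimate.  Composition and evaluation of
    bounded operators are both instances. *)
Lemma abs_continuous_bilinear {U V W} (m : U -> V -> W) a b f g :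
  (forall x x' y, m (x - x') y = m x y - m x' y) ->
  (forall x y y', m x (y - y') = m x y - m x y') ->
  (forall x y, rnorm (m x y) <= rnorm x * rnorm y) ->
  abs_continuous_itv a b f -> abs_continuous_itv a b g ->
  abs_continuous_itv a b (fun t => m (f t) (g t)).
Proof.
move=> ml mr mb fac gac e e0.
have [M M0 fM] := abs_continuous_bounded fac.
have [N N0 gN] := abs_continuous_bounded gac.
have K0 : 0 < M + N + 1 by lra.
have e'0 : 0 < e / (M + N + 1) by rewrite divr_gt0.
have [d d0 fd] := fac _ e'0; have [d' d'0 gd] := gac _ e'0.
exists (Num.min d d'); first by rewrite lt_min d0.
move=> n l r lr dj; rewrite lt_min => /andP[sd sd'].
have := fd n l r lr dj sd; have := gd n l r lr dj sd'.
rewrite (incr_sumE f l r) (incr_sumE g l r).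
rewrite (incr_sumE (fun t => m (f t) (g t)) l r) !ltcR => gl fl.
apply: (@le_lt_trans _ _ (incr_sum f l r * N + M * incr_sum g l r)).
  rewrite /incr_sum mulr_suml mulr_sumr -big_split/=; apply: ler_sum => i _.
  have [al lri rb] := lr i.
  have rab : a <= r i <= b by apply/andP; split; lra.
  have lab : a <= l i <= b by apply/andP; split; lra.
  have -> : m (f (r i)) (g (r i)) - m (f (l i)) (g (l i)) =
      m (f (r i) - f (l i)) (g (r i)) + m (f (l i)) (g (r i) - g (l i)).
    by rewrite ml mr addrA subrK.
  apply: le_trans (rnormD _ _) _; apply: lerD; apply: le_trans (mb _ _) _.
    by rewrite ler_wpM2l ?rnorm_ge0// gN.
  by rewrite ler_wpM2r ?rnorm_ge0// fM.
have -> : e = e / (M + N + 1) * (M + N + 1) by field; lra.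
move: (e / _) => q in gl fl e'0 *.
have h1 : incr_sum f l r * N <= q * N by rewrite ler_wpM2r// ltW.
have h2 : M * incr_sum g l r <= M * q by rewrite ler_wpM2l// ltW.
nra.
Qed.

Lemma abs_continuous_comp {U V W} a b (S : R -> bop V W) (T : R -> bop U V) :
  abs_continuous_itv a b S -> abs_continuous_itv a b T ->
  abs_continuous_itv a b (fun t => S t *o T t).
Proof.
apply: abs_continuous_bilinear => [x x' y|x y y'|x y].
- by apply: bop_ext.
- by apply: bop_ext => v /=; rewrite linearB.
- exact: rnorm_comp.
Qed.

Lemma abs_continuous_app {V W} a b (T : R -> bop V W) (u : R -> V) :
  abs_continuous_itv a b T -> abs_continuous_itv a b u ->
  abs_continuous_itv a b (fun t => T t (u t)).
Proof.
apply: (abs_continuous_bilinear (m := fun (S : bop V W) x => S x)) => //.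
- by move=> x y y'; rewrite linearB.
- exact: rnorm_op.
Qed.

End AbsoluteContinuity.

(** * Derivatives of operator functions *)

Section Derivatives.
Set Implicit Arguments.
Unset Strict Implicit.
Context {R : realType}.
Implicit Types U V W : normedModType R[i].

Lemma near0_itv (a b t : R) : a < t < b ->
  \forall h \near (0 : R)^', a < t + h < b.
Proof.
move=> /andP[at_ tb].
have e0 : 0 < Num.min (t - a) (b - t) by rewrite lt_min !subr_gt0 at_.
apply: filterS (dnbhs0_lt e0) => h; rewrite lt_min ltr_norml => /andP[/andP[h1 _]].
rewrite ltr_norml => /andP[_ h2]; apply/andP; split; lra.
Qed.

Lemma abs_continuous_near_bounded {V} (f : R -> V) a b t :
  abs_continuous_itv a b f -> a < t < b ->
  exists M, \forall h \near (0 : R)^', rnorm (f (t + h)) <= M.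
Proof.
move=> /abs_continuous_bounded[M _ fM] tab; exists M.
by apply: filterS (near0_itv tab) => h /andP[ah hb]; apply: fM; rewrite !ltW.
Qed.

Lemma normr_dnbhs0 (K : R) : K * `|h| @[h --> (0 : R)^'] --> (0 : R).
Proof.
apply: cvg0M; apply/cvgrPdist_lt => e e0.
by apply: filterS (dnbhs0_lt e0) => h; rewrite sub0r normrN normr_id.
Qed.

Lemma has_deriv_cvg {V} (f : R -> V) t df : has_deriv f t df ->
  rnorm (f (t + h) - f t) @[h --> (0 : R)^'] --> (0 : R).
Proof.
move=> /cvg_rnormP/cvgrPdist_lt/(_ 1 ltr01) near1.
apply: cvg0_le (normr_dnbhs0 (rnorm df + 1)).
apply: filterS2 near1 (nbhs_dnbhs_neq (0 : R)) => h.
set q := (h^-1)%:C *: (f (t + h) - f t).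
rewrite sub0r normrN ger0_norm ?rnorm_ge0// => qd h0.
have -> : f (t + h) - f t = h%:C *: q.
  by rewrite scalerA -rmorphM/= mulfV// scale1r.
rewrite rnormZ rnorm_real mulrC ler_wpM2r//.
by have := rnormD (q - df) df; rewrite subrK; lra.
Qed.

Lemma has_deriv_near {V} (f g : R -> V) (a b t : R) df : a < t < b ->
  (forall s, a < s < b -> f s = g s) -> has_deriv f t df -> has_deriv g t df.
Proof.
move=> tab fg; apply: cvg_trans; apply: near_eq_cvg.
by apply: filterS (near0_itv tab) => h hab; rewrite !fg.
Qed.

Lemma has_derivD {V} (f g : R -> V) t df dg :
  has_deriv f t df -> has_deriv g t dg ->
  has_deriv (fun s => f s + g s) t (df + dg).
Proof.
move=> fd gd; rewrite /has_deriv.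
under eq_fun do rewrite opprD addrACA scalerDr.
exact: cvgD.
Qed.

Lemma has_deriv_op {V W} (T : bop V W) (f : R -> V) t df :
  has_deriv f t df -> has_deriv (fun s => T (f s)) t (T df).
Proof.
move=> /cvg_rnormP fd; apply/cvg_rnormP.
apply: (@cvg0_le _ _ _ _ _ (fun h => rnorm T * rnorm ((h^-1)%:C *: (f (t + h) - f t) - df))).
  by apply: nearW => h; rewrite rnorm_ge0/= -linearB -linearZ -linearB rnorm_op.
exact: cvg0M.
Qed.

(** The difference quotient of T u is split so that the quotient of u stands
    under the moving operator T (t + h), which converges to T t only strongly:
    the local norm bound M absorbs the error of that quotient, and strong
    continuity of T is applied to the fixed vector du. *)
Lemma has_deriv_app {V W} (T : R -> bop V W) (u : R -> V) t dT du M :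
  (\forall h \near (0 : R)^', rnorm (T (t + h)) <= M) ->
  has_strong_deriv T t dT -> has_deriv u t du ->
  has_deriv (fun s => T s (u s)) t (dT (u t) + T t du).
Proof.
move=> TM Td /cvg_rnormP ud; apply/cvg_rnormP.
have /cvg_rnormP Tu := Td (u t); have Tdu := has_deriv_cvg (Td du).
pose q h := (h^-1)%:C *: (u (t + h) - u t).
pose p h := (h^-1)%:C *: (T (t + h) (u t) - T t (u t)).
pose g h := M * rnorm (q h - du) + rnorm (p h - dT (u t)) +
            rnorm (T (t + h) du - T t du).
apply: (@cvg0_le _ _ _ _ _ g); last first.
  by apply: cvg0D Tdu; apply: cvg0D Tu; exact: cvg0M.
apply: filterS TM => h hM; rewrite rnorm_ge0/=.
have -> : (h^-1)%:C *: (T (t + h) (u (t + h)) - T t (u t)) - (dT (u t) + T t du) =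
    T (t + h) (q h - du) + (p h - dT (u t)) + (T (t + h) du - T t du).
  have -> : (h^-1)%:C *: (T (t + h) (u (t + h)) - T t (u t)) = T (t + h) (q h) + p h.
    by rewrite /q /p linearZ/= -scalerDr (linearB (T (t + h))) addrA subrK.
  rewrite (linearB (T (t + h))) [RHS]addrA.
  by rewrite [_ - _ + (p h - _)]addrAC subrK opprD !addrA.
apply: le_trans (rnormD _ _) _; rewrite lerD2r.
apply: le_trans (rnormD _ _) _; rewrite lerD2r.
by apply: le_trans (rnorm_op _ _) _; rewrite ler_wpM2r ?rnorm_ge0.
Qed.

End Derivatives.

(** * Points of an interval up to null sets *)

Section Interior.
Set Implicit Arguments.
Unset Strict Implicit.
Context {R : realType}.
Local Notation mu := (@lebesgue_measure R).

Lemma negligible_subset1 (A : set R) : is_subset1 A -> mu.-negligible A.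
Proof.
move=> A1; have [[x Ax]|A0] := pselect (exists x, A x); last first.
  suff -> : A = set0 by exact: negligible_set0.
  by apply/seteqP; split=> // x Ax; apply: A0; exists x.
have Nx : mu.-negligible [set x].
  apply/negligibleP => //; exact: lebesgue_measure_set1.
by apply: negligibleS Nx => y Ay; exact: A1.
Qed.

(** Two-sided derivatives are only meaningful inside I; the at most two points
    discarded here are the minimum and the maximum of I. *)
Lemma ae_interior (I : interval R) :
  {ae mu, forall t, t \in I -> exists a b, [/\ a \in I, b \in I & a < t < b]}.
Proof.
have min1 : is_subset1 [set x | x \in I /\ forall y, y \in I -> x <= y].
  by move=> x y [xI lx] [yI ly]; apply/eqP; rewrite eq_le lx ?ly.
have max1 : is_subset1 [set x | x \in I /\ forall y, y \in I -> y <= x].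
  by move=> x y [xI ux] [yI uy]; apply/eqP; rewrite eq_le ux ?uy.
have := negligibleU (negligible_subset1 min1) (negligible_subset1 max1).
apply: negligibleS => t /= /not_implyP[tI nab].
have [tmin|/existsNP[a /not_implyP[aI /negP]]] :=
  pselect (forall y, y \in I -> t <= y); first by left.
rewrite -ltNge => at_; right; split=> // b bI; rewrite leNgt; apply/negP => tb.
by apply: nab; exists a, b; rewrite at_ tb.
Qed.

(** A nondegenerate subinterval has positive measure, so a property valid almost
    everywhere on I has a witness. *)
Lemma ae_pick (P : R -> Prop) (I : interval R) a b :
  a \in I -> b \in I -> a < b ->
  {ae mu, forall t, t \in I -> P t} -> exists2 s, s \in I & P s.
Proof.
move=> aI bI ab aeP; apply: contrapT => nP.
have : mu.-negligible `[a, b].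
  apply: negligibleS aeP => t tab /= tP; apply: nP; exists t.
    by apply: (interval_is_interval aI bI); move: tab; rewrite /= in_itv.
  by apply: tP; apply: (interval_is_interval aI bI); move: tab; rewrite /= in_itv.
move=> /negligibleP -/(_ (measurable_itv _)) ab0.
have := etrans (esym ab0) (lebesgue_measure_itv `[a, b]).
rewrite /= lte_fin ab -EFinD => -[/eqP].
by rewrite eq_sym subr_eq0 gt_eqF.
Qed.

End Interior.

(** * Inverses and similarity *)

Section Inverses.
Set Implicit Arguments.
Unset Strict Implicit.
Context {R : realType}.
Implicit Types V W : normedModType R[i].

(** Identifies the choice made by [binv] with any inverse found by hand. *)
Lemma binv_unique {V W} (T : bop V W) (S : bop W V) : binverse T S -> binv T = S.
Proof.
move=> TS; apply: (xget_unique 0 TS) => S' [_ S'T]; apply: bop_ext => y.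
have [TS1 _] := TS.
rewrite -[in LHS](congr1 (fun B : bop W W => B y) TS1 : T (S y) = y).
exact: (congr1 (fun B : bop V V => B (S y)) S'T).
Qed.

Lemma binvP {V W} (T : bop V W) : binvertible T -> binverse T (binv T).
Proof. by move=> iT; exact: xgetPex. Qed.

Section Similarity.
Variables (V W : normedModType R[i]) (A : bop V V) (B : bop W W).
Variables (F : bop V W) (G : bop W V).
Hypotheses (FG : F *o G = bid) (GF : G *o F = bid) (FA : F *o A = B *o F).

(** z - B = F (z - A) G, whose inverse is the conjugate of that of z - A. *)
Lemma resolvent_similar z S : binverse (z *: bid - A) S ->
  binverse (z *: bid - B) (F *o S *o G).
Proof.
have FGe x : F (G x) = x := congr1 (fun T : bop W W => T x) FG.
have GFe x : G (F x) = x := congr1 (fun T : bop V V => T x) GF.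
have FAe x : F (A x) = B (F x) := congr1 (fun T : bop V W => T x) FA.
move=> [AS SA]; split; apply: bop_ext => x.
  have ASe : z *: S (G x) - A (S (G x)) = G x.
    exact: (congr1 (fun T : bop V V => T (G x)) AS).
  change (z *: F (S (G x)) - B (F (S (G x))) = x).
  by rewrite -FAe -linearZ -linearB ASe; exact: FGe.
have SAe y : S (z *: y - A y) = y := congr1 (fun T : bop V V => T y) SA.
change (F (S (G (z *: x - B x))) = x).
have -> : G (z *: x - B x) = z *: G x - A (G x).
  by rewrite -[in LHS](FGe x) -FAe -linearZ -linearB; exact: GFe.
by rewrite SAe FGe.
Qed.

End Similarity.

Lemma spectrum_similar {V W} (A : bop V V) (B : bop W W) (F : bop V W) (G : bop W V) :
  F *o G = bid -> G *o F = bid -> F *o A = B *o F -> spectrum B `<=` spectrum A.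
Proof.
move=> FG GF FA z nB [S AS]; apply: nB; exists (F *o S *o G).
exact: resolvent_similar AS.
Qed.

End Inverses.

(** * The resolvent near infinity *)

Section Neumann.
Set Implicit Arguments.
Unset Strict Implicit.
Context {R : realType}.

Lemma cvg_half (K : R) : K * 2^-1 ^+ n @[n --> \oo] --> (0 : R).
Proof. by apply: (@cvg_geometric _ K); rewrite ger0_norm; lra. Qed.

(** Picard iteration from 0.  With ratio 1/2 the whole orbit stays within
    2 * rnorm (g 0), which bounds the tails without summing a geometric series. *)
Lemma half_contraction_fixpoint (V : completeNormedModType R[i]) (g : V -> V) :
  (forall x y, rnorm (g x - g y) <= 2^-1 * rnorm (x - y)) -> exists x, x = g x.
Proof.
move=> gh; pose s n := iter n g 0.
have sub n m : rnorm (s (n + m)%N - s n) <= 2^-1 ^+ n * rnorm (s m).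
  elim: n => [|n IH]; first by rewrite add0n /s/= subr0 expr0 mul1r.
  rewrite addSn /s /= -!/(s _) exprS -mulrA.
  by apply: le_trans (gh _ _) _; rewrite ler_wpM2l// invr_ge0.
have sM m : rnorm (s m) <= 2 * rnorm (s 1%N).
  elim: m => [|m IH]; first by rewrite /s/= rnorm0 mulr_ge0 ?rnorm_ge0.
  have := sub 1%N m; rewrite add1n expr1.
  by have := rnormD (s m.+1 - s 1%N) (s 1%N); rewrite subrK; lra.
have s_cvg : cvgn s.
  apply: cauchy_cvg; apply: cauchy_exP => e e0.
  have [-> {}e0] := posC_real e0.
  have /cvgrPdist_lt/(_ _ e0) [N _ HN] := cvg_half (2 * rnorm (s 1%N)).
  exists (s N); exists N => // n /= Nn.
  rewrite -ball_normE /= normE ltcR -/(rnorm _) rnormB -(subnKC Nn).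
  apply: le_lt_trans (sub _ _) _; apply: le_lt_trans (HN N (leqnn N)).
  rewrite sub0r normrN ger0_norm; last first.
    by rewrite !mulr_ge0 ?rnorm_ge0// exprn_ge0// invr_ge0.
  by rewrite mulrC ler_wpM2r// exprn_ge0// invr_ge0.
pose x := limn s; have sx : s n @[n --> \oo] --> x := s_cvg.
exists x; apply: (@cvg_unique _ (@norm_hausdorff _ V) (s n.+1 @[n --> \oo])).
  by move: sx; rewrite -(cvg_shiftS s).
apply/cvg_rnormP; move/cvg_rnormP: sx => sx.
apply: (@cvg0_le _ _ _ _ _ (fun n => 2^-1 * rnorm (s n - x))); last exact: cvg0M.
by apply: nearW => n; rewrite rnorm_ge0 gh.
Qed.

(** The equation z x - A x = y says that x is a fixed point of
    x |-> z^-1 (y + A x), a contraction of ratio at most 1/2 under the stated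
    bound; the lower bound on z x - A x gives uniqueness of the solution and
    boundedness of the solution operator. *)
Lemma resolvent_exists (V : completeNormedModType R[i]) (A : bop V V) (z : R[i]) :
  (2 * rnorm A)%:C < `|z| -> binvertible (z *: bid - A).
Proof.
move=> Az; have rz : `|z| = (rnorm (z : R[i]^o))%:C := normE (z : R[i]^o).
move: Az; rewrite rz ltcR => Az; have A0 := rnorm_ge0 A.
have z0 : z != 0.
  by apply/eqP => z0; move: Az; rewrite z0 rnorm0; lra.
pose r := rnorm (z : R[i]^o); have r0 : 0 < r by rewrite /r; lra.
have lower x : r * rnorm x <= 2 * rnorm (z *: x - A x).
  have := rnormD (z *: x - A x) (A x); rewrite subrK rnormZ -/r => h.
  have := rnorm_op A x; have := rnorm_ge0 x; rewrite -/r in Az; nra.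
have inj x : z *: x - A x = 0 -> x = 0.
  move=> x0; apply: rnorm_eq0; apply/eqP; rewrite eq_le rnorm_ge0 andbT.
  have := lower x; rewrite x0 rnorm0 mulr0 => h.
  by rewrite -(pmulr_rle0 _ r0).
have surj y : exists x, z *: x - A x = y.
  have [|x xE] := @half_contraction_fixpoint V (fun x => z^-1 *: (y + A x)).
    move=> x x'; 
    have -> : z^-1 *: (y + A x) - z^-1 *: (y + A x') = z^-1 *: A (x - x').
      by rewrite -scalerBr (linearB A) opprD addrACA subrr add0r.
    rewrite rnormZ.
    have -> : rnorm (z^-1 : R[i]^o) = r^-1.
      apply: (mulfI (lt0r_neq0 r0)); rewrite mulfV ?gt_eqF//.
      by have := rnormZ z (z^-1 : R[i]^o); rewrite /GRing.scale/= mulfV// => <-; rewrite /rnorm normr1.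
    rewrite mulrC ler_pdivrMr//.
    apply: le_trans (rnorm_op _ _) _.
    have := rnorm_ge0 (x - x'); rewrite -/r in Az; nra.
  exists x; rewrite {1}xE scalerA mulfV// scale1r addrK //.
pose S y := projT1 (cid (surj y)).
have SP y : z *: S y - A (S y) = y by rewrite /S; case: cid.
have SK x : S (z *: x - A x) = x.
  apply/eqP; rewrite -subr_eq0; apply/eqP; apply: inj.
  by rewrite scalerBr (linearB A) opprD addrACA SP -opprD subrr.
have lS : linear S.
  move=> a x y; rewrite -[RHS]SK; congr S.
  rewrite (linearP A) scalerDr opprD addrACA scalerA mulrC -scalerA -scalerBr.
  by rewrite !SP.
have bS : op_bound S !=set0.
  exists (2 / r); split=> [|y]; first by rewrite divr_ge0// ltW.
  rewrite (normE y) (normE (S y)) -rmorphM lecR -/(rnorm _) -/(rnorm _).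
  by rewrite mulrAC ler_pdivlMr// mulrC -[in leRHS](SP y).
have pS : S \in @bounded_linear R V V by apply/bounded_linearP.
exists (Bop pS); split; apply: bop_ext => y; first exact: (SP y).
change (S (z *: y - A y) = y); exact: SK.
Qed.

End Neumann.

Section AnalyticAtInfinity.
Set Implicit Arguments.
Unset Strict Implicit.
Context {R : realType} (V : completeNormedModType R[i]) (E Es : normedModType R[i]).
Variables (A : bop V V) (B : bop E V) (C : bop V Es) (D : bop E Es).

Let AB n : bop E V := iter n (fun P : bop E V => A *o P) B.

(** Taylor coefficients at w = 0 of w |-> D + C (w^-1 - A)^-1 B, the Markov
    parameters of the system (A, B, C, D). *)
Definition markov n : bop E Es := if n is m.+1 then C *o AB m else D.

Lemma rnorm_AB n : rnorm (AB n) <= rnorm A ^+ n * rnorm B.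
Proof.
elim: n => [|n IH]; first by rewrite expr0 mul1r.
rewrite /AB iterS -/(AB n) exprS -mulrA.
by apply: le_trans (rnorm_comp _ _) _; rewrite ler_wpM2l ?rnorm_ge0.
Qed.

(** The hypothesis on T is T (1 - w A) = w, which (w^-1 - A)^-1 satisfies for
    w <> 0 and the zero operator for w = 0; stating it this way treats the point
    at infinity together with its neighbours.  Each further Taylor term peels
    one factor w A off the remainder. *)
Lemma markov_remainder (w : R[i]) (T : bop V V) n :
  (forall x, T x = w *: x + w *: T (A x)) ->
  (D + C *o T *o B) - series (fun k => (w - 0) ^+ k *: markov k) n.+1 =
  w ^+ n *: (C *o T *o AB n).
Proof.
move=> TE; elim: n => [|n IH].
  rewrite /series /= big_nat1 !expr0 !scale1r.
  by rewrite addrAC subrr add0r.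
rewrite /series /= big_nat_recr//= opprD addrA IH subr0 [in LHS]exprS.
apply: bop_ext => x.
change (w ^+ n *: C (T (AB n x)) - (w * w ^+ n) *: C (AB n x) =
        w ^+ n.+1 *: C (T (A (AB n x)))).
rewrite TE linearD scalerDr !linearZ/= !scalerA -exprS.
by rewrite scalerN addrAC subrr add0r.
Qed.

(** On |w| < 1 / (2 (|A| + 1)) the remainder after n + 1 terms is at most
    |C T| |B| / 2^n. *)
Lemma resolvent_analytic_at_infty :
  analytic_at_infty (~` spectrum A)
    (fun z => D + C *o binv (z *: bid - A) *o B) D.
Proof.
split; first by exists (2 * rnorm A) => z zA; apply; exact: resolvent_exists.
exists markov; have A0 := rnorm_ge0 A.
have d0 : 0 < (2 * (rnorm A + 1))^-1 by rewrite invr_gt0; lra.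
have d0C : 0 < ((2 * (rnorm A + 1))^-1)%:C by rewrite ltcR.
apply: filterS (nbhs0_lt (V := R[i]^o) d0C) => w.
rewrite normE ltcR -/(rnorm _) -[_^-1]mul1r ltr_pdivlMr; last lra.
set r := rnorm _ => rA; have r0 : 0 <= r by exact: rnorm_ge0.
set f := (if _ then _ else _).
(* T extends w |-> (w^-1 - A)^-1 by 0 at w = 0 *)
have [T [TE fE]] : exists T : bop V V, (forall x, T x = w *: x + w *: T (A x)) /\
    f = D + C *o T *o B.
  have [w0|w0] := eqVneq w 0.
    exists 0; split=> [x|]; first by rewrite w0 !scale0r addr0.
    rewrite /f w0 eqxx; apply: bop_ext => x.
    change (D x = D x + C 0); by rewrite linear0 addr0.
  exists (binv (w^-1 *: bid - A)); split; last by rewrite /f (negbTE w0).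
  have iA : binvertible (w^-1 *: bid - A).
    apply: resolvent_exists; rewrite normfV normE -fmorphV ltcR -/(rnorm _) -/r.
    have r1 : 0 < r.
      by rewrite lt_neqAle r0 andbT eq_sym; apply/eqP => /rnorm_eq0/eqP; exact/negP.
    by rewrite -[_^-1]mul1r ltr_pdivlMr//; lra.
  have [_ TA] := binvP iA; set T := binv _ in TA *.
  move=> x; have TAx : T (w^-1 *: x - A x) = x := congr1 (fun S : bop V V => S x) TA.
  by rewrite -[in w *: x]TAx -scalerDr linearB subrK linearZ/= scalerA mulfV// scale1r.
apply/cvg_rnormP; rewrite -cvg_shiftS.
apply: (@cvg0_le _ _ _ _ _
  (fun n => rnorm (C *o T) * rnorm B * 2^-1 ^+ n)); last exact: cvg_half.
apply: nearW => n; rewrite rnorm_ge0/= rnormB fE markov_remainder// rnormZ rnormX -/r.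
have -> : rnorm (C *o T) * rnorm B * 2^-1 ^+ n = 2^-1 ^+ n * (rnorm (C *o T) * rnorm B).
  by rewrite mulrC.
apply: (@le_trans _ _ (r ^+ n * (rnorm (C *o T) * (rnorm A ^+ n * rnorm B)))).
  rewrite ler_wpM2l ?exprn_ge0//; apply: le_trans (rnorm_comp _ _) _.
  by rewrite ler_wpM2l ?rnorm_ge0// rnorm_AB.
rewrite [X in r ^+ n * X]mulrCA [X in X <= _]mulrA -exprMn.
rewrite ler_wpM2r ?mulr_ge0 ?rnorm_ge0//; apply: lerXn2r; rewrite ?nnegrE.
- by rewrite mulr_ge0.
- by rewrite invr_ge0.
- by nra.
Qed.

End AnalyticAtInfinity.

(** * Transfer functions of vessels *)

Section Vessel.
Set Implicit Arguments.
Unset Strict Implicit.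
Context {R : realType} {I : interval R} {X : vessel_data R} (hX : is_vessel I X).
Implicit Types (z : R[i]) (s t : R).
Local Notation mu := (@lebesgue_measure R).

Definition FB s t := vF X s t *o vBt X t *o sigma1 X t.
Definition CF s t := vC X t *o vF X t s.

Lemma vF_cancel s t : s \in I -> t \in I -> vF X s t *o vF X t s = bid.
Proof. by move=> sI tI; rewrite (vF_comp hX)// (vF_id hX). Qed.

Lemma spectrum_const s t : s \in I -> t \in I ->
  spectrum (vA1 X t) = spectrum (vA1 X s).
Proof.
have sub p q : p \in I -> q \in I -> spectrum (vA1 X p) `<=` spectrum (vA1 X q).
  move=> pI qI; apply: (@spectrum_similar _ _ _ _ _ (vF X p q) (vF X q p)).
  - exact: vF_cancel.
  - exact: vF_cancel.
  - exact: (vF_A1 hX).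
by move=> sI tI; apply/seteqP; split; exact: sub.
Qed.

Lemma transfer_analytic t :
  analytic_at_infty (~` spectrum (vA1 X t)) (fun z => transfer X z t) (vD X t).
Proof.
have := resolvent_analytic_at_infty (vA1 X t) (vBt X t *o sigma1 X t) (vC X t) (vD X t).
by congr analytic_at_infty; apply/funext => z; apply: bop_ext.
Qed.

Section Resolvent.
Variable z : R[i].
Hypothesis hz : forall t, t \in I -> ~ spectrum (vA1 X t) z.

Let res t := binv (z *: bid - vA1 X t).

Lemma resP t : t \in I -> binverse (z *: bid - vA1 X t) (res t).
Proof. by move=> tI; apply: binvP; apply: contrapT => /(hz tI). Qed.

Lemma res_transport s t : s \in I -> t \in I ->
  res t = vF X t s *o res s *o vF X s t.
Proof.
move=> sI tI; apply: binv_unique; apply: resolvent_similar (resP sI).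
- exact: vF_cancel.
- exact: vF_cancel.
- exact: (vF_A1 hX).
Qed.

(** The resolvent is moved to the fixed base point s, so that t enters only
    through factors whose regularity is part of the definition of a vessel. *)
Lemma transfer_transport s t : s \in I -> t \in I ->
  transfer X z t = vD X t + CF s t *o (res s *o FB s t).
Proof.
by move=> sI tI; rewrite /transfer -/(res t) (res_transport sI tI); apply: bop_ext.
Qed.

Lemma transfer_abs_continuous : abs_continuous I (transfer X z).
Proof.
move=> a b aI bI; have [ba|ab] := leP b a; first exact: abs_continuous_degenerate.
have [s sI [FBac _ CFac]] := ae_pick aI bI ab (vFB_ac hX).
apply: (@abs_continuous_eq _ _ _ _ (fun t => vD X t + CF s t *o (res s *o FB s t))).
  move=> t /(interval_is_interval aI bI) tI; exact/esym/transfer_transport.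
apply: abs_continuousD; first exact: (vD_ac hX).
apply: abs_continuous_comp; first exact: CFac.
apply: abs_continuous_comp; last exact: FBac.
exact: abs_continuous_cst.
Qed.

(** [dy] is the derivative of y = D u + CF (res s) FB u given by the product
    rule.  Put r = (z - A_1)^-1 B sigma_1 u at time t, so that y = D u + C r.
    The state part of the input equation collapses, since the resolvent meets
    (z - A_1) B sigma_2 u ([tailE]); the term sigma_1* C B sigma_2 u it produces
    is cancelled by the linkage condition, as is sigma_2* C B sigma_1 u coming
    from A_1 r = z r - B sigma_1 u. *)
Lemma output_equation s t (u du : vE X) (dFB : bop (vE X) (vH X s))
    (dCF : bop (vH X s) (vEs X)) (dD : bop (vE X) (vEs X)) :
  s \in I -> t \in I ->
  z *: sigma2 X t u - sigma1 X t du + gamma X t u = 0 ->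
  dFB + vF X s t *o vA1 X t *o vBt X t *o sigma2 X t
      + vF X s t *o vBt X t *o gamma X t = 0 ->
  sigma2s X t *o vC X t *o vA1 X t *o vF X t s - sigma1s X t *o dCF
      + gammas X t *o vC X t *o vF X t s = 0 ->
  vDt X t *o gamma X t =
    sigma2s X t *o vC X t *o vBt X t *o sigma1 X t
    - sigma1s X t *o vC X t *o vBt X t *o sigma2 X t
    - sigma1s X t *o dD + gammas X t *o vD X t ->
  let y := transfer X z t u in
  let dy := (dD u + vD X t du) +
    (dCF (res s (FB s t u)) + CF s t (res s (dFB u + FB s t du))) in
  z *: sigma2s X t y - sigma1s X t dy + gammas X t y = 0.
Proof.
move=> sI tI ode ode_FB ode_CF link y dy.
pose P := vF X s t; pose Q := vF X t s; pose C := vC X t; pose B := vBt X t.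
pose r := Q (res s (P (B (sigma1 X t u)))).
have [resR resL] := resP tI; rewrite (res_transport sI tI) in resR resL.
have rE : z *: r - vA1 X t r = B (sigma1 X t u) :=
  congr1 (fun T : bop (vH X t) (vH X t) => T (B (sigma1 X t u))) resR.
have rL x : Q (res s (P (z *: x - vA1 X t x))) = x :=
  congr1 (fun T : bop (vH X t) (vH X t) => T x) resL.
have yE : y = vD X t u + C r.
  by rewrite /y (transfer_transport sI tI).
have uE : sigma1 X t du = z *: sigma2 X t u + gamma X t u.
  by apply/eqP; rewrite -subr_eq0 -oppr_eq0 opprB addrAC ode.
have FBE : dFB u + FB s t du = P (z *: B (sigma2 X t u) - vA1 X t (B (sigma2 X t u))).
  have h : dFB u + P (vA1 X t (B (sigma2 X t u))) + P (B (gamma X t u)) = 0 :=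
    congr1 (fun T : bop (vE X) (vH X s) => T u) ode_FB.
  have -> : FB s t du = P (B (sigma1 X t du)) by [].
  have -> : dFB u = - (P (vA1 X t (B (sigma2 X t u))) + P (B (gamma X t u))).
    by apply/eqP; rewrite -addr_eq0 addrA h.
  rewrite uE (linearD B) (linearD P) (linearB P) !linearZ/=.
  by rewrite opprD addrACA addNr addr0 addrC.
have CFE : sigma1s X t (dCF (res s (FB s t u))) =
    z *: sigma2s X t (C r) - sigma2s X t (C (B (sigma1 X t u))) + gammas X t (C r).
  have h : sigma2s X t (C (vA1 X t r)) - sigma1s X t (dCF (res s (FB s t u)))
      + gammas X t (C r) = 0 :=
    congr1 (fun T : bop (vH X s) (vEst X) => T (res s (FB s t u))) ode_CF.
  have rA : vA1 X t r = z *: r - B (sigma1 X t u).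
    by rewrite -rE opprB addrC subrK.
  move: h; rewrite rA (linearB C) (linearB (sigma2s X t)).
  rewrite !linearZ/= addrAC => /eqP.
  by rewrite subr_eq0 => /eqP <-.
have s1D x : sigma1s X t (vD X t x) = vDt X t (sigma1 X t x) :=
  congr1 (fun T : bop (vE X) (vEst X) => T x) (link_sigma1 hX tI).
have s2D x : sigma2s X t (vD X t x) = vDt X t (sigma2 X t x) :=
  congr1 (fun T : bop (vE X) (vEst X) => T x) (link_sigma2 hX tI).
have linkE : vDt X t (gamma X t u) =
    sigma2s X t (C (B (sigma1 X t u))) - sigma1s X t (C (B (sigma2 X t u)))
    - sigma1s X t (dD u) + gammas X t (vD X t u) :=
  congr1 (fun T : bop (vE X) (vEst X) => T u) link.
have tailE : CF s t (res s (dFB u + FB s t du)) = C (B (sigma2 X t u)).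
  by rewrite FBE; exact: (congr1 C (rL _)).
suff -> : sigma1s X t dy = z *: sigma2s X t y + gammas X t y.
  by rewrite addrAC subrr.
rewrite /dy tailE yE !(linearD (sigma1s X t)) !(linearD (sigma2s X t)).
rewrite (linearD (gammas X t))/= s1D uE (linearD (vDt X t)) linearZ/=.
rewrite -s2D linkE CFE scalerDr.
(* the three pairs grouped first are opposite and cancel *)
rewrite [LHS](AC ((1*(1*4))*4)
  (((1*5)*(3*8)*(4*10))*((2*7)*(6*9))))/=.
by rewrite !subrr addNr !add0r.
Qed.

Lemma transfer_maps_solutions (u : R -> vE X) :
  is_solution I z (sigma2 X) (sigma1 X) (gamma X) u ->
  is_solution I z (sigma2s X) (sigma1s X) (gammas X) (fun t => transfer X z t (u t)).
Proof.
have ae_filter : Filter (almost_everywhere mu) := ae_filter_ringOfSetsType mu.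
move=> [u_ac u_ode]; split=> [a b aI bI|].
  exact: abs_continuous_app (transfer_abs_continuous aI bI) (u_ac _ _ aI bI).
(* over an interval with at most one point there is nothing to differentiate *)
have [[a [b [aI bI ab]]]|I_small] :=
    pselect (exists a b, [/\ a \in I, b \in I & a < b]); last first.
  apply: filterS (ae_interior I) => t tP tI; exfalso; apply: I_small.
  have [p [q [pI qI /andP[pt tq]]]] := tP tI.
  by exists p, q; split=> //; exact: lt_trans tq.
have [s sI [FBac _ CFac]] := ae_pick aI bI ab (vFB_ac hX).
apply: filterS2 (filterI (ae_interior I) u_ode)
  (filterI (link_gamma hX) (filterI (vB_ode hX sI) (vC_ode hX sI))).
move=> t [t_int u_odet] [linkt [ode_FBt ode_CFt]] tI.
have [p [q [pI qI tpq]]] := t_int tI.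
have [du u_du ode] := u_odet tI.
have [dD D_dD link] := linkt tI.
have [dFB FB_dFB ode_FB] := ode_FBt tI.
have [dCF CF_dCF ode_CF] := ode_CFt tI.
have [MD D_near] := abs_continuous_near_bounded (vD_ac hX pI qI) tpq.
have [MB FB_near] := abs_continuous_near_bounded (FBac _ _ pI qI) tpq.
have [MC CF_near] := abs_continuous_near_bounded (CFac _ _ pI qI) tpq.
eexists; last exact: output_equation sI tI ode ode_FB ode_CF link.
apply: (@has_deriv_near _ _
  (fun r => vD X r (u r) + CF s r (res s (FB s r (u r)))) _ p q) => //.
  move=> r rpq; rewrite (transfer_transport sI)//.
  by apply: (interval_is_interval pI qI); case/andP: rpq => /ltW-> /ltW->.
apply: has_derivD; first exact: has_deriv_app D_near D_dD u_du.
apply: has_deriv_app CF_near CF_dCF _; apply: has_deriv_op.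
exact: has_deriv_app FB_near FB_dFB u_du.
Qed.

End Resolvent.

End Vessel.

Theorem theorem3p4 (R : realType) (I : interval R) (X : vessel_data R)
    (hX : is_vessel I X) :
  [/\ forall t s, t \in I -> s \in I -> spectrum (vA1 X t) = spectrum (vA1 X s),
      {ae @lebesgue_measure R, forall t, t \in I ->
        analytic_at_infty (~` spectrum (vA1 X t))
          (fun z => transfer X z t) (vD X t)},
      forall z : R[i], (forall t, t \in I -> ~ spectrum (vA1 X t) z) ->
        abs_continuous I (transfer X z)
    & forall z : R[i], (forall t, t \in I -> ~ spectrum (vA1 X t) z) ->
        forall u : R -> vE X,
          is_solution I z (sigma2 X) (sigma1 X) (gamma X) u ->
          is_solution I z (sigma2s X) (sigma1s X) (gammas X)
            (fun t => transfer X z t (u t))].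
Proof.
split.
- by move=> t s tI sI; exact: spectrum_const hX _ _ sI tI.
- by apply: aeW => t _; exact: transfer_analytic.
- by move=> z hz; exact: transfer_abs_continuous.
- by move=> z hz u; exact: transfer_maps_solutions.
Qed.
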